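(* Let $C_1^4,\dots,C_{16}^4$ be the nonassociative code loops of rank $4$ with characteristic vectors \begin{align*} &\lambda(C_1^4)=(1110110100),\ \lambda(C_2^4)=(0000000000),\ \lambda(C_3^4)=(0000110100),\ \lambda(C_4^4)=(0010100000),\\ &\lambda(C_5^4)=(0000010100),\ \lambda(C_6^4)=(1111110100),\ \lambda(C_7^4)=(0001000000),\ \lambda(C_8^4)=(0000001000),\\ &\lambda(C_9^4)=(0100001000),\ \lambda(C_{10}^4)=(0001111000),\ \lambda(C_{11}^4)=(0001001000),\ \lambda(C_{12}^4)=(0000001100),\\ &\lambda(C_{13}^4)=(0110111100),\ \lambda(C_{14}^4)=(0001001100),\ \lambda(C_{15}^4)=(1001001100),\ \lambda(C_{16}^4)=(0001111100). \end{align*} For each $i=1,\dots,16$, the code $V_i$ spanned by the four generators listed below is a minimal representation of $C_i^4$. Here vectors are identified with subsets of $\{1,\dots,m_i\}$, $V_i$ is regarded as a subspace of $\mathbb{F}_2^{m_i}$ with $m_i$ the largest integer occurring in the listed generators of $V_i$, and $[p,q]$ denotes the set of integers $\{p,p+1,\dots,q\}$: \begin{align*} V_1&=\langle \{1,2,3,4\},\ \{1,2,5,6\},\ \{1,3,5,7\},\ [1,8]\rangle,\\ V_2&=\langle [1,8],\ [1,4]\cup[9,12],\ \{1,5,6,7,9,10,11,13\},\ \{1,2,5,8,9,12,13,14\}\rangle,\\ V_3&=\langle [1,8],\ [1,6]\cup\{9,10\},\ \{1,2,3,4,5,7,9,11\},\ \{1\}\cup[6,12]\rangle,\\ V_4&=\langle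 [1,8],\ [1,6]\cup\{9,10\},\ \{1,2,3,7,9\}\cup[11,17],\ \{1,4,7,8,9,10,11,18\}\rangle,\\ V_5&=\langle [1,8],\ \{1,2,3,4,9,10,11,12\},\ \{1,5,9\}\cup[13,17],\ \{1,2,5,6,9,10,13,18\}\rangle,\\ V_6&=\langle \{1,2,3,4\},\ \{1,2,5,6\},\ \{1,3,5,7\},\ \{8,9,10,11\}\rangle,\\ V_7&=\langle [1,8],\ \{1,2,3,4,9,10,11,12\},\ \{1,5,6,7,9,10,11,13\},\ \{14,15,16,17\}\rangle,\\ V_8&=\langle [1,8],\ [1,4]\cup[9,12],\ \{1,2,3,5,9,13,14,15\},\ \{1,2,10,11,13,14,16,17\}\rangle,\\ V_9&=\langle [1,8],\ [1,4]\cup[9,16],\ \{1,5,6,7,9,10,11,17\},\ \{5,6,9,10,12,13,18,19\}\rangle,\\ V_{10}&=\langle [1,8],\ \{1,2\}\cup[9,14],\ \{1,3,9,10,11,15,16,17\},\ \{4,5,18,19\}\rangle,\\ V_{11}&=\langle [1,8],\ [1,4]\cup[9,12],\ \{1,2,3,5,9,13,14,15\},\ \{6,7,16,17\}\rangle,\\ V_{12}&=\langle [1,8],\ [1,4]\cup[9,12],\ \{1,2,3,5,9,10,11,13\},\ \{1,2,9,10,14,15,16,17\}\rangle,\\ V_{13}&=\langle [1,8],\ \{1,2,9,10\},\ \{1,3,9,11\},\ \{4,5,12,13,14,15,16,17\}\rangle,\\ V_{14}&=\langle [1,8],\ [1,4]\cup[9,12],\ \{1,2,3,5,9,10,11,13\},\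 \{1,2,9,10\}\rangle,\\ V_{15}&=\langle [1,12],\ [1,4]\cup[13,16],\ \{1,2,3,5,13,14,15,17\},\ \{1,2,13,14\}\rangle,\\ V_{16}&=\langle [1,8],\ \{1,2,9,10,11,12,13,14\},\ \{1,3,9,10,11,12,13,15\},\ \{4,5,16,17\}\rangle. \end{align*}
   Context: Identify $\mathbb{F}_2^m$ with the set of all subsets of $I_m=\{1,\dots,m\}$ (a vector corresponds to its support; addition is symmetric difference), and let $\langle\cdots\rangle$ denote the $\mathbb{F}_2$-linear span. For $v\in\mathbb{F}_2^m$, $|v|$ is the Hamming weight, and $|v\cap w|$, $|v\cap w\cap u|$ are the sizes of the intersections of supports. A doubly even binary code is a subspace $V\subseteq \mathbb{F}_2^m$ with $|v|\equiv 0 \pmod 4$ for all $v\in V$. Code loops. Given a doubly even code $V$, a factor set is a function $\phi:V\times V\to\{1,-1\}$ with $\phi(v,v)=(-1)^{|v|/4}$, $\phi(v,w)=(-1)^{|v\cap w|/2}\phi(w,v)$, $\phi(0,v)=\phi(v,0)=1$, and $\phi(v+w,u)=\phi(v,w+u)\phi(v,w)\phi(w,u)(-1)^{|v\cap w\cap u|}$ for all $u,v,w\in V$. The code loop $L(V)$ is the set $\{1,-1\}\times V$ with, writing $v=(1,v)$ and $-v=(-1,v)$, the product $v\cdot w=\phi(v,w)(v+w)$, $v\cdot(-w)=(-v)\cdot w=-(v\cdot w)$, $(-v)\cdot(-w)=v\cdot w$. It is a Moufang loop, well defined up to isomorphism, and its rank is $\dim_{\mathbb{F}_2}V$. Here $1$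 and $-1$ also denote the elements $(1,0)$ and $(-1,0)$ of $L(V)$. All squares, commutators $[x,y]=x^{-1}y^{-1}xy$ and associators $(x,y,z)=((xy)z)(x(yz))^{-1}$ lie in $\{1,-1\}$. Characteristic vectors in rank $4$. A nonassociative code loop $L$ of rank $4$ has a basis (generating set) $a,b,c,d$ for which $(a,b,c)=-1$ is the only nontrivial associator among the basis elements, i.e. $(a,b,d)=(a,c,d)=(b,c,d)=1$. Its characteristic vector with respect to such a basis is $\lambda(L)=(\lambda_1\lambda_2\cdots\lambda_{10})\in\mathbb{F}_2^{10}$ where $a^2=(-1)^{\lambda_1}$, $b^2=(-1)^{\lambda_2}$, $c^2=(-1)^{\lambda_3}$, $d^2=(-1)^{\lambda_4}$, $[a,b]=(-1)^{\lambda_5}$, $[a,c]=(-1)^{\lambda_6}$, $[a,d]=(-1)^{\lambda_7}$, $[b,c]=(-1)^{\lambda_8}$, $[b,d]=(-1)^{\lambda_9}$, $[c,d]=(-1)^{\lambda_{10}}$. ''The code loop with characteristic vector $\lambda$'' means the nonassociative code loop of rank $4$ (unique up to isomorphism) having some such basis with respect to which its characteristic vector is $\lambda$. Representations. A representation of a code loop $L$ is a doubly even code $V\subseteq\mathbb{F}_2^m$ with $L\cong L(V)$ (isomorphism of loops); $m$ is called the degree of the representation. A representation of $L$ is minimal if its degree is the smallest possible among the representations of $L$. *)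

(* Defs.v *)
From HB Require Import structures.
From mathcomp Require Import all_boot all_order all_algebra.
Set Implicit Arguments.
Unset Strict Implicit.
Unset Printing Implicit Defensive.

Import GRing.Theory.
Local Open Scope ring_scope.

Definition supp m (v : 'rV['F_2]_m) : {set 'I_m} := [set i | v 0 i != 0].

Definition wt m (v : 'rV['F_2]_m) : nat := #|supp v|.

Definition doubly_even m (V : {vspace 'rV['F_2]_m}) : Prop :=
  forall v, v \in V -> (4 %| wt v)%N.

(** The sign group {1, -1} is encoded by [bool] with [addb]: the boolean [e]
   stands for (-1)^e. *)

Record factor_set m (V : {vspace 'rV['F_2]_m})
    (phi : subvs_of V -> subvs_of V -> bool) : Prop := FactorSet {
  fs_diag : forall v, phi v v = odd (wt (vsval v) %/ 4);
  fs_swap : forall v w,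
    phi v w = odd (#|supp (vsval v) :&: supp (vsval w)| %/ 2) (+) phi w v;
  fs_0l : forall v, phi 0 v = false;
  fs_0r : forall v, phi v 0 = false;
  fs_cocycle : forall u v w,
    phi (v + w) u = phi v (w + u) (+) phi v w (+) phi w u
      (+) odd #|supp (vsval v) :&: supp (vsval w) :&: supp (vsval u)| }.

Record code_loop m (V : {vspace 'rV['F_2]_m}) := CodeLoop {
  cl_factor : subvs_of V -> subvs_of V -> bool;
  cl_doubly_even : doubly_even V;
  cl_factor_set : factor_set cl_factor }.

Definition cl_elt m (V : {vspace 'rV['F_2]_m}) (L : code_loop V) : Type :=
  (bool * subvs_of V)%type.

Coercion cl_elt : code_loop >-> Sortclass.

Section CodeLoopOps.
Variables (m : nat) (V : {vspace 'rV['F_2]_m}) (L : code_loop V).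
Implicit Types x y : L.

Definition cl_mul x y : L :=
  (x.1 (+) y.1 (+) cl_factor L x.2 y.2, x.2 + y.2).

(** (-1)^e as an element of the loop. *)
Definition cl_sign (e : nat) : L := (odd e, 0).

(** As v + v = 0, the inverse of (s, v) is (s phi(v, v), v); see [cl_mulVx] and
   [cl_mulxV]. *)
Definition cl_inv x : L := (x.1 (+) cl_factor L x.2 x.2, x.2).

HB.instance Definition _ := hasMul.Build (cl_elt L) cl_mul.
HB.instance Definition _ := hasOne.Build (cl_elt L) (cl_sign 0).
HB.instance Definition _ := hasInv.Build (cl_elt L) cl_inv.

Lemma subvs_addvv (v : subvs_of V) : v + v = 0.
Proof.
apply/val_inj/rowP => i; rewrite /= !mxE.
by case: (vsval v 0 i) => -[|[|//]] ? /=; apply/val_inj.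
Qed.

Lemma cl_mul1x x : (1 * x = x)%g.
Proof.
case: x => s v; rewrite /monoid.mul /= /cl_mul /= (fs_0l (cl_factor_set L)).
by rewrite addbF add0r.
Qed.

Lemma cl_mulx1 x : (x * 1 = x)%g.
Proof.
case: x => s v; rewrite /monoid.mul /= /cl_mul /= (fs_0r (cl_factor_set L)).
by rewrite !addbF addr0.
Qed.

Lemma cl_mulVx x : (x^-1 * x = 1)%g.
Proof.
case: x => s v; rewrite /monoid.mul /= /cl_mul /= subvs_addvv.
by case: s (cl_factor _ _ _) => [] [].
Qed.

Lemma cl_mulxV x : (x * x^-1 = 1)%g.
Proof.
case: x => s v; rewrite /monoid.mul /= /cl_mul /= subvs_addvv.
by case: s (cl_factor _ _ _) => [] [].
Qed.

Definition associator x y z : L := ((x * y * z) * (x * (y * z))^-1)%g.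

Definition loop_generates (s : seq L) : Prop :=
  forall S : {pred L},
    1%g \in S -> {in S &, forall x y, (x * y)%g \in S} ->
    {in S, forall x, (x^-1)%g \in S} -> {subset s <= S} -> forall x, x \in S.

Definition nonassociative_loop : Prop := ~ associative (@monoid.mul L).

(** [lam] is stored from index 0, so lambda_j is entry [j.-1]. *)
Definition is_char_vector (lam : 10.-tuple 'F_2) (a b c d : L) : Prop :=
  let lambda j := cl_sign (nth 0 lam j.-1 : 'F_2) in
  [/\ loop_generates [:: a; b; c; d],
      [/\ associator a b c = cl_sign 1%N, associator a b d = 1%g,
          associator a c d = 1%g & associator b c d = 1%g],
      [/\ (a ^+ 2)%g = lambda 1%N, (b ^+ 2)%g = lambda 2%N,
          (c ^+ 2)%g = lambda 3%N & (d ^+ 2)%g = lambda 4%N],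
      [/\ [~ a, b]%g = lambda 5%N, [~ a, c]%g = lambda 6%N
        & [~ a, d]%g = lambda 7%N]
    & [/\ [~ b, c]%g = lambda 8%N, [~ b, d]%g = lambda 9%N
        & [~ c, d]%g = lambda 10%N]].

Definition rank4_code_loop_with (lam : 10.-tuple 'F_2) : Prop :=
  [/\ \dim V = 4%N, nonassociative_loop
    & exists a b c d : L, is_char_vector lam a b c d].

End CodeLoopOps.

Definition loop_isomorphic (G H : magmaType) : Prop :=
  exists f : {multiplicative G -> H}, bijective f.

Section Representations.
Variables (n : nat) (W : {vspace 'rV['F_2]_n}) (L : code_loop W).

Definition representation m (V : {vspace 'rV['F_2]_m}) : Prop :=
  exists L' : code_loop V, loop_isomorphic L L'.

Definition minimal_representation m (V : {vspace 'rV['F_2]_m}) : Prop :=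
  representation V /\
  forall m' (V' : {vspace 'rV['F_2]_m'}), representation V' -> (m <= m')%N.

End Representations.

(** The index [i : 'I_16] is 0-based: it refers to the (i+1)-st loop. *)

Definition lambda4 (i : 'I_16) : 10.-tuple 'F_2 :=
  tnth [tuple
    [tuple 1; 1; 1; 0; 1; 1; 0; 1; 0; 0];
    [tuple 0; 0; 0; 0; 0; 0; 0; 0; 0; 0];
    [tuple 0; 0; 0; 0; 1; 1; 0; 1; 0; 0];
    [tuple 0; 0; 1; 0; 1; 0; 0; 0; 0; 0];
    [tuple 0; 0; 0; 0; 0; 1; 0; 1; 0; 0];
    [tuple 1; 1; 1; 1; 1; 1; 0; 1; 0; 0];
    [tuple 0; 0; 0; 1; 0; 0; 0; 0; 0; 0];
    [tuple 0; 0; 0; 0; 0; 0; 1; 0; 0; 0];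
    [tuple 0; 1; 0; 0; 0; 0; 1; 0; 0; 0];
    [tuple 0; 0; 0; 1; 1; 1; 1; 0; 0; 0];
    [tuple 0; 0; 0; 1; 0; 0; 1; 0; 0; 0];
    [tuple 0; 0; 0; 0; 0; 0; 1; 1; 0; 0];
    [tuple 0; 1; 1; 0; 1; 1; 1; 1; 0; 0];
    [tuple 0; 0; 0; 1; 0; 0; 1; 1; 0; 0];
    [tuple 1; 0; 0; 1; 0; 0; 1; 1; 0; 0];
    [tuple 0; 0; 0; 1; 1; 1; 1; 1; 0; 0]] i.

Definition nat_range (p q : nat) : seq nat := iota p (q.+1 - p).

Definition gens4 (i : 'I_16) : seq (seq nat) :=
  (tnth [tuple
    [:: [:: 1; 2; 3; 4];
        [:: 1; 2; 5; 6];
        [:: 1; 3; 5; 7];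
        nat_range 1 8];
    [:: nat_range 1 8;
        nat_range 1 4 ++ nat_range 9 12;
        [:: 1; 5; 6; 7; 9; 10; 11; 13];
        [:: 1; 2; 5; 8; 9; 12; 13; 14]];
    [:: nat_range 1 8;
        nat_range 1 6 ++ [:: 9; 10];
        [:: 1; 2; 3; 4; 5; 7; 9; 11];
        [:: 1] ++ nat_range 6 12];
    [:: nat_range 1 8;
        nat_range 1 6 ++ [:: 9; 10];
        [:: 1; 2; 3; 7; 9] ++ nat_range 11 17;
        [:: 1; 4; 7; 8; 9; 10; 11; 18]];
    [:: nat_range 1 8;
        [:: 1; 2; 3; 4; 9; 10; 11; 12];
        [:: 1; 5; 9] ++ nat_range 13 17;
        [:: 1; 2; 5; 6; 9; 10; 13; 18]];
    [:: [:: 1; 2; 3; 4];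
        [:: 1; 2; 5; 6];
        [:: 1; 3; 5; 7];
        [:: 8; 9; 10; 11]];
    [:: nat_range 1 8;
        [:: 1; 2; 3; 4; 9; 10; 11; 12];
        [:: 1; 5; 6; 7; 9; 10; 11; 13];
        [:: 14; 15; 16; 17]];
    [:: nat_range 1 8;
        nat_range 1 4 ++ nat_range 9 12;
        [:: 1; 2; 3; 5; 9; 13; 14; 15];
        [:: 1; 2; 10; 11; 13; 14; 16; 17]];
    [:: nat_range 1 8;
        nat_range 1 4 ++ nat_range 9 16;
        [:: 1; 5; 6; 7; 9; 10; 11; 17];
        [:: 5; 6; 9; 10; 12; 13; 18; 19]];
    [:: nat_range 1 8;
        [:: 1; 2] ++ nat_range 9 14;
        [:: 1; 3; 9; 10; 11; 15; 16; 17];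
        [:: 4; 5; 18; 19]];
    [:: nat_range 1 8;
        nat_range 1 4 ++ nat_range 9 12;
        [:: 1; 2; 3; 5; 9; 13; 14; 15];
        [:: 6; 7; 16; 17]];
    [:: nat_range 1 8;
        nat_range 1 4 ++ nat_range 9 12;
        [:: 1; 2; 3; 5; 9; 10; 11; 13];
        [:: 1; 2; 9; 10; 14; 15; 16; 17]];
    [:: nat_range 1 8;
        [:: 1; 2; 9; 10];
        [:: 1; 3; 9; 11];
        [:: 4; 5; 12; 13; 14; 15; 16; 17]];
    [:: nat_range 1 8;
        nat_range 1 4 ++ nat_range 9 12;
        [:: 1; 2; 3; 5; 9; 10; 11; 13];
        [:: 1; 2; 9; 10]];
    [:: nat_range 1 12;
        nat_range 1 4 ++ nat_range 13 16;
        [:: 1; 2; 3; 5; 13; 14; 15; 17];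
        [:: 1; 2; 13; 14]];
    [:: nat_range 1 8;
        [:: 1; 2; 9; 10; 11; 12; 13; 14];
        [:: 1; 3; 9; 10; 11; 12; 13; 15];
        [:: 4; 5; 16; 17]]] i)%N.

Definition degree4 (i : 'I_16) : nat :=
  (\max_(g <- gens4 i) \max_(j <- g) j)%N.

(** Subsets are listed with elements in {1, ..., m}, whereas the elements of
   ['I_m] are 0, ..., m-1. *)
Definition vec_of m (g : seq nat) : 'rV['F_2]_m :=
  \row_(j < m) (j.+1 \in g)%:R.

Definition V4 (i : 'I_16) : {vspace 'rV['F_2]_(degree4 i)} :=
  <<[seq vec_of (degree4 i) g | g <- gens4 i]>>%VS.

(* Main.v *)
Require Import Defs.
From HB Require Import structures.
From mathcomp Require Import all_boot all_order all_algebra.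
From mathcomp Require Import zify.

Set Implicit Arguments.
Unset Strict Implicit.
Unset Printing Implicit Defensive.

Import GRing.Theory.
Local Open Scope ring_scope.

(** A doubly even code carries three functions with values in the field with
    two elements: |v|/4, |v ∩ w|/2 and |u ∩ v ∩ w| modulo 2, called [sqbit],
    [commbit] and [assocbit] below.  In a code loop over the code they are the
    exponents of -1 in squares, commutators and associators.  The argument
    rests on two facts about them.

    They are invariants of the loop.  When some associator is -1, an
    isomorphism of code loops must send -1 to -1, because it sends an
    associator, which is a sign, to an associator; so it preserves all three
    functions ([iso_sqbit], [iso_commbit], [iso_assocbit]).

    They are determined by their values on generators.  From
    |v + w| + 2 |v ∩ w| = |v| + |w| it follows that [commbit] measures the
    failure of [sqbit] to be additive, that [assocbit] measures the failure of
    [commbit] to be biadditive, and that [assocbit] is triadditive.  Hence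
    two bases with the same characteristic vector give a linear bijection of
    the codes that respects all three functions ([span_same_sqbit] and its
    companions), and such a bijection carries a factor set of one code to a
    factor set of the other ([transport_representation]).

    As the listed generators of V_i do have the characteristic vector
    lambda(C_i) ([gens4_ok]), the code V_i represents every code loop with this
    vector.  Such loops exist because every doubly even code has a factor set,
    built by adjoining one generator after the other ([factor_on_cons]).

    For minimality, let a, b, c, d be the vectors that an isomorphism
    produces in another representation, of length m.  Sort the m coordinates
    into cells according to which of a, b, c, d contain them.  The
    characteristic vector gives |a| modulo 8, |a ∩ b| modulo 4,
    |a ∩ b ∩ c| modulo 2 and likewise for the other subsets, so by
    inclusion-exclusion the sizes of the 15 cells inside a ∪ b ∪ c ∪ d are known
    modulo 4 once |a ∩ b ∩ c ∩ d| modulo 4 and the second binary digits of the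
    four triple intersections are chosen: 64 possibilities
    ([cell_residueP]).  The sum of the residues is a lower bound for m.  It
    improves by 4 when the residues themselves violate the conditions modulo
    8, and the part of it that concerns the cells inside d can be replaced by
    the least positive value allowed for |d| ([residue_boundP]).  The better
    of the two bounds reaches the degree of V_i in each of the 64 cases
    ([degree4_bound]). *)

(** * The invariants of a doubly even code *)

Lemma F2_neq0D (x y : 'F_2) : (x + y != 0) = (x != 0) (+) (y != 0).
Proof. by case: x y => [[|[|//]] ?] [[|[|//]] ?]. Qed.

Lemma F2_scaleE (V : lmodType 'F_2) (k : 'F_2) (v : V) :
  k *: v = v *+ (k != 0).
Proof.
case: k => [[|[|//]] lt_k].
  by rewrite (_ : Ordinal _ = 0) ?scale0r //; apply/val_inj.
by rewrite (_ : Ordinal _ = 1) ?scale1r //; apply/val_inj.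
Qed.

Section Invariants.
Variable m : nat.
Implicit Types u v w : 'rV['F_2]_m.

Definition sqbit v : bool := odd (wt v %/ 4).
Definition commbit v w : bool := odd (#|supp v :&: supp w| %/ 2).
Definition assocbit u v w : bool := odd #|supp u :&: supp v :&: supp w|.

Lemma rV2_addvv v : v + v = 0.
Proof.
by apply/rowP => i; rewrite !mxE; case: (v 0 i) => -[|[|//]] ?; apply/val_inj.
Qed.

Lemma supp0 : supp (0 : 'rV['F_2]_m) = set0.
Proof. by apply/setP => i; rewrite !inE mxE eqxx. Qed.

(** The source of all polarization identities: a coordinate of [A] in exactly
    one of the two supports is counted once on both sides, a coordinate in both
    supports twice. *)
Lemma card_suppD v w (A : {set 'I_m}) :
  (#|supp (v + w) :&: A| + 2 * #|supp v :&: supp w :&: A|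
   = #|supp v :&: A| + #|supp w :&: A|)%N.
Proof.
have cE (B : {set 'I_m}) : #|B| = (\sum_(i : 'I_m) (i \in B))%N.
  by rewrite -sum1_card big_mkcond; apply: eq_bigr => i _; case: (i \in B).
rewrite !cE big_distrr -!big_split; apply: eq_bigr => i _ /=.
rewrite !inE mxE F2_neq0D.
by case: (v 0 i != 0) (w 0 i != 0) (i \in A) => [] [] [].
Qed.

Lemma wtD v w : (wt (v + w) + 2 * #|supp v :&: supp w| = wt v + wt w)%N.
Proof. by have := card_suppD v w [set: 'I_m]; rewrite !setIT. Qed.

Lemma card_supp2D u v w :
  (#|supp u :&: supp (v + w)| + 2 * #|supp u :&: supp v :&: supp w|
   = #|supp u :&: supp v| + #|supp u :&: supp w|)%N.
Proof.
by rewrite -setIA !(setIC (supp u)); apply: card_suppD.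
Qed.

Lemma assocbitC u v w : assocbit u v w = assocbit v u w.
Proof. by rewrite /assocbit (setIC (supp u)). Qed.

Lemma assocbitAC u v w : assocbit u v w = assocbit u w v.
Proof. by rewrite /assocbit setIAC. Qed.

Lemma assocbitDl u v w z :
  assocbit (u + v) w z = assocbit u w z (+) assocbit v w z.
Proof.
rewrite /assocbit -!setIA -oddD -card_suppD oddD oddM.
by rewrite addbF.
Qed.

Lemma assocbitDm u v w z :
  assocbit u (v + w) z = assocbit u v z (+) assocbit u w z.
Proof. by rewrite assocbitC assocbitDl !(assocbitC _ u). Qed.

Lemma assocbitDr u v w z :
  assocbit u v (w + z) = assocbit u v w (+) assocbit u v z.
Proof. by rewrite assocbitAC assocbitDm !(assocbitAC u v). Qed.

Lemma assocbit0 u v : assocbit 0 u v = false.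
Proof. by rewrite /assocbit supp0 !set0I cards0. Qed.

Lemma commbitC u v : commbit u v = commbit v u.
Proof. by rewrite /commbit setIC. Qed.

Lemma commbit0 u : commbit 0 u = false.
Proof. by rewrite /commbit supp0 set0I cards0. Qed.

Lemma sqbit0 : sqbit 0 = false.
Proof. by rewrite /sqbit /wt supp0 cards0. Qed.

Section DoublyEven.
Variable V : {vspace 'rV['F_2]_m}.
Hypothesis deV : doubly_even V.

Lemma even_suppI v w : v \in V -> w \in V -> ~~ odd #|supp v :&: supp w|.
Proof.
move=> Vv Vw; have := wtD v w.
have := deV Vv; have := deV Vw; have := deV (memvD Vv Vw).
by move: (wt _) (wt _) (wt _) #|_| => a b c d; lia.
Qed.

Lemma sqbitD v w : v \in V -> w \in V ->
  sqbit (v + w) = sqbit v (+) sqbit w (+) commbit v w.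
Proof.
move=> Vv Vw; have := wtD v w; rewrite /sqbit /commbit.
move=> wtE; apply: (canRL (addbK _)); rewrite -!oddD; congr odd; move: wtE.
have := deV Vv; have := deV Vw; have := deV (memvD Vv Vw).
have := even_suppI Vv Vw; lia.
Qed.

Lemma commbitDr u v w : u \in V -> v \in V -> w \in V ->
  commbit u (v + w) = commbit u v (+) commbit u w (+) assocbit u v w.
Proof.
move=> Vu Vv Vw; have := card_supp2D u v w; rewrite /commbit /assocbit.
move=> cE; apply: (canRL (addbK _)); rewrite -!oddD; congr odd; move: cE.
have := even_suppI Vu Vv; have := even_suppI Vu Vw.
have := even_suppI Vu (memvD Vv Vw); lia.
Qed.

Lemma commbitDl u v w : u \in V -> v \in V -> w \in V ->
  commbit (u + v) w = commbit u w (+) commbit v w (+) assocbit u v w.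
Proof.
move=> Vu Vv Vw; rewrite commbitC commbitDr // !(commbitC w).
by rewrite assocbitC assocbitAC.
Qed.

Lemma commbitvv v : v \in V -> commbit v v = false.
Proof. by move=> /deV; rewrite /wt /commbit setIid; lia. Qed.

Lemma assocbitvv v w : v \in V -> w \in V -> assocbit v v w = false.
Proof.
by move=> Vv Vw; rewrite /assocbit setIid; apply/negbTE/even_suppI.
Qed.

End DoublyEven.
End Invariants.

(** Over the field with two elements the span of a list is reached from 0 by
    adding members of the list one at a time. *)
Lemma span2_ind m (X : seq 'rV['F_2]_m) (P : 'rV['F_2]_m -> Prop) :
  P 0 -> (forall x v, x \in X -> v \in <<X>>%VS -> P v -> P (x + v)) ->
  {in <<X>>%VS, forall v, P v}.
Proof.
move=> P0 PD; suff H Y : {subset Y <= X} -> {in <<Y>>%VS, forall v, P v}.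
  exact: (H X).
elim: Y => [|x Y IH] sYX v; first by rewrite span_nil memv0 => /eqP->.
rewrite span_cons => /memv_addP[_ /vlineP[k ->] [w Yw ->]].
have sYX' : {subset Y <= X} by move=> y Yy; apply: sYX; rewrite inE Yy orbT.
have Pw := IH sYX' w Yw.
rewrite F2_scaleE; case: (k != 0); rewrite ?mulr0n ?add0r //.
apply: PD => //; first by rewrite sYX ?mem_head.
by apply/(subvP (sub_span _)): Yw.
Qed.

(** Evenness of the pairwise intersections makes the span self-orthogonal, and
    then [wtD] keeps weights divisible by 4. *)
Lemma doubly_even_span m (X : seq 'rV['F_2]_m) :
  {in X, forall x, 4 %| wt x}%N ->
  {in X &, forall x y, ~~ odd #|supp x :&: supp y|} ->
  doubly_even <<X>>%VS.
Proof.
move=> X4 X2.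
have oddI x v w : odd #|supp x :&: supp (v + w)|
    = odd #|supp x :&: supp v| (+) odd #|supp x :&: supp w|.
  by have := card_supp2D x v w; lia.
have X2' x v : x \in X -> v \in <<X>>%VS -> ~~ odd #|supp x :&: supp v|.
  move=> Xx; apply: (span2_ind (P := fun v => ~~ odd #|supp x :&: supp v|)).
    by rewrite supp0 setI0 cards0.
  move=> y w Xy _ xw.
  by rewrite oddI negb_add (negbTE xw) (negbTE (X2 x y _ _)).
apply: (span2_ind (P := fun v => is_true (4 %| wt v)%N)) => [|x v Xx Xv v4].
  by rewrite /wt supp0 cards0.
by have := wtD x v; have := X4 x Xx; have := X2' x v Xx Xv; lia.
Qed.

(** * The invariants on a span are determined by the generators *)

Section SameInvariants.
Variables (m n : nat) (X : seq 'rV['F_2]_m) (W : {vspace 'rV['F_2]_n}).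
Variable g : {linear 'rV['F_2]_m -> 'rV['F_2]_n}.
Hypothesis deX : doubly_even <<X>>%VS.
Hypothesis deW : doubly_even W.
Hypothesis gX : {in X, forall x, g x \in W}.
Hypothesis g_sq : {in X, forall x, sqbit (g x) = sqbit x}.
Hypothesis g_comm : {in X &, forall x y, commbit (g x) (g y) = commbit x y}.
Hypothesis g_assoc :
  {in X & &, forall x y z, assocbit (g x) (g y) (g z) = assocbit x y z}.

Lemma span_image : {in <<X>>%VS, forall v, g v \in W}.
Proof.
apply: span2_ind => [|x v Xx _ Wv]; first by rewrite linear0 mem0v.
by rewrite linearD memvD // gX.
Qed.

Lemma span_same_assocbit : {in <<X>>%VS & &, forall u v w,
  assocbit (g u) (g v) (g w) = assocbit u v w}.
Proof.
have a1 : {in X & X & <<X>>%VS, forall x y w,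
    assocbit (g x) (g y) (g w) = assocbit x y w}.
  move=> x y w Xx Xy; move: w; apply: (@span2_ind _ X) => [|z w Xz _ IH].
    by rewrite linear0 !(assocbitAC _ _ 0) !(assocbitC _ 0) !assocbit0.
  by rewrite linearD !assocbitDr IH g_assoc.
have a2 : {in X & <<X>>%VS & <<X>>%VS, forall x v w,
    assocbit (g x) (g v) (g w) = assocbit x v w}.
  move=> x v w Xx Xv Xw; move: v Xv; apply: span2_ind => [|z v Xz _ IH].
    by rewrite linear0 !(assocbitC _ 0) !assocbit0.
  by rewrite linearD !assocbitDm IH a1.
move=> u v w Xu Xv Xw; move: u Xu; apply: span2_ind => [|z u Xz _ IH].
  by rewrite linear0 !assocbit0.
by rewrite linearD !assocbitDl IH a2.
Qed.

Lemma span_same_commbit : {in <<X>>%VS &, forall u v,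
  commbit (g u) (g v) = commbit u v}.
Proof.
have sX : {subset X <= <<X>>%VS} by move=> x; apply: memv_span.
have gE := span_image; have aE := span_same_assocbit.
have c1 : {in X & <<X>>%VS, forall x v, commbit (g x) (g v) = commbit x v}.
  move=> x v Xx; move: v; apply: (@span2_ind _ X) => [|z v Xz Xv IH].
    by rewrite linear0 !(commbitC _ 0) !commbit0.
  rewrite linearD (commbitDr deW) ?(commbitDr deX) ?gE // ?sX //.
  by rewrite IH g_comm ?aE // ?sX.
move=> u v Xu Xv; move: u Xu; apply: span2_ind => [|z u Xz Xu IH].
  by rewrite linear0 !commbit0.
rewrite linearD (commbitDl deW) ?(commbitDl deX) ?gE // ?sX //.
by rewrite IH c1 ?aE // ?sX.
Qed.

Lemma span_same_sqbit : {in <<X>>%VS, forall v, sqbit (g v) = sqbit v}.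
Proof.
have sX : {subset X <= <<X>>%VS} by move=> x; apply: memv_span.
apply: span2_ind => [|x v Xx Xv IH]; first by rewrite linear0 !sqbit0.
rewrite linearD (sqbitD deW) ?(sqbitD deX) ?span_image // ?sX //.
by rewrite IH g_sq ?span_same_commbit // ?sX.
Qed.

End SameInvariants.

(** * Existence of factor sets *)

Section Existence.
Variable m : nat.
Implicit Types (V : {vspace 'rV['F_2]_m}) (X : seq 'rV['F_2]_m).

(** The conditions on a factor set, for a function of ambient vectors: this lets
    a factor set of a subcode be extended without changing its type. *)
Record factor_on V (phi : 'rV['F_2]_m -> 'rV['F_2]_m -> bool) : Prop :=
  FactorOn {
  fo_diag : {in V, forall v, phi v v = sqbit v};
  fo_swap : {in V &, forall v w, phi v w = commbit v w (+) phi w v};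
  fo_0l : {in V, forall v, phi 0 v = false};
  fo_0r : {in V, forall v, phi v 0 = false};
  fo_cocycle : {in V & &, forall u v w,
    phi (v + w) u = phi v (w + u) (+) phi v w (+) phi w u
      (+) assocbit v w u} }.

(** If [x] is a new generator, the formula
      phi'(v + e x, w + f x)
        = phi(v, w) + f commbit(v, x) + e f sqbit(x) + e assocbit(x, v, w)
    extends the factor set phi.  The second and third terms give the right
    diagonal and swap rule; the last one repairs the associativity condition,
    since [commbit] is not additive in [v]. *)
Lemma factor_on_cons x X phi : doubly_even <<x :: X>>%VS ->
  factor_on <<X>>%VS phi -> exists phi', factor_on <<x :: X>>%VS phi'.
Proof.
move=> deV phiP; set U := <<X>>%VS in phiP *.
have [Ux | nUx] := boolP (x \in U).
  exists phi; suff -> : <<x :: X>>%VS = U by [].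
  by rewrite span_cons; apply/addv_idPr/subvP => v /vlineP[k ->]; rewrite memvZ.
(* [v \notin U] is the coefficient of [x] in [v], and [p] removes that term. *)
pose p v := if v \in U then v else v + x.
pose phi' v w := phi (p v) (p w) (+) (w \notin U) && commbit (p v) x
  (+) [&& v \notin U, w \notin U & sqbit x]
  (+) (v \notin U) && assocbit x (p v) (p w).
have sUV v : v \in U -> v \in <<x :: X>>%VS.
  by move=> Uv; rewrite span_cons -[v]add0r memv_add ?mem0v.
have Vx : x \in <<x :: X>>%VS by rewrite memv_span ?mem_head.
have xbP (b : bool) : (x *+ b \in <<x :: X>>%VS) by case: b; rewrite ?mem0v.
have dec v : v \in <<x :: X>>%VS ->
    exists2 v0, v0 \in U & exists e : bool, v = v0 + x *+ e.
  rewrite span_cons => /memv_addP[_ /vlineP[k ->] [v0 Uv0 ->]].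
  by exists v0 => //; exists (k != 0); rewrite F2_scaleE addrC.
have inU v0 (e : bool) : v0 \in U -> (v0 + x *+ e \in U) = ~~ e.
  move=> Uv0; case: e; rewrite ?addr0 //.
  apply/negbTE; apply: contra nUx => Uv0x.
  have -> : x = (v0 + x) + v0 by rewrite addrAC rV2_addvv add0r.
  exact: memvD.
have pE v0 (e : bool) : v0 \in U -> p (v0 + x *+ e) = v0.
  move=> Uv0; rewrite /p inU //; case: e; rewrite ?addr0 //=.
  by rewrite -addrA rV2_addvv addr0.
pose ext v w (e f : bool) :=
  f && commbit v x (+) [&& e, f & sqbit x] (+) e && assocbit x v w.
have phiE v w (e f : bool) : v \in U -> w \in U ->
    phi' (v + x *+ e) (w + x *+ f) = phi v w (+) ext v w e f.
  by move=> Uv Uw; rewrite /phi' /ext !pE // !inU // !negbK !addbA.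
have deU : doubly_even U by move=> v /sUV; apply: deV.
have xD v w (e f : bool) :
    (v + x *+ e) + (w + x *+ f) = (v + w) + x *+ (e (+) f).
  rewrite addrACA; congr (_ + _).
  by case: e f => [] []; rewrite ?addr0 ?add0r // rV2_addvv.
have xV v (e : bool) : v \in U -> v + x *+ e \in <<x :: X>>%VS.
  by move=> Uv; rewrite memvD ?xbP ?sUV.
have ax (b : bool) y z : assocbit (x *+ b) y z = b && assocbit x y z.
  by case: b; rewrite ?assocbit0.
have ayx (b : bool) y z : assocbit y (x *+ b) z = b && assocbit x y z.
  by rewrite assocbitC ax.
have ayzx (b : bool) y z : assocbit y z (x *+ b) = b && assocbit x y z.
  by rewrite assocbitAC ayx assocbitAC.
have assocE := (assocbitDl, assocbitDm, assocbitDr, ax, ayx, ayzx).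
have cyx (b : bool) y : commbit y (x *+ b) = b && commbit y x.
  by case: b; rewrite // commbitC commbit0.
have sq2 v (e : bool) : v \in U ->
    sqbit (v + x *+ e) = sqbit v (+) e && sqbit x (+) e && commbit v x.
  by move=> Uv; rewrite (sqbitD deV) // ?sUV // cyx; case: e; rewrite ?sqbit0.
have assoc3 v w u (e f g : bool) : v \in U -> w \in U -> u \in U ->
    assocbit (v + x *+ e) (w + x *+ f) (u + x *+ g) = assocbit v w u
      (+) (e && assocbit x w u (+) f && assocbit x v u (+) g && assocbit x v w).
  move=> Uv Uw Uu; rewrite !assocE !(assocbitvv deV) // ?sUV // !andbF !addbF.
  move: (assocbit v w u) (assocbit x v w) (assocbit x v u) (assocbit x w u).
  by case: e f g => [] [] [] [] [] [] [].
have comm2 v w (e f : bool) : v \in U -> w \in U ->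
    commbit (v + x *+ e) (w + x *+ f) = commbit v w (+) f && commbit v x
      (+) e && commbit w x (+) (e (+) f) && assocbit x v w.
  move=> Uv Uw; rewrite (commbitDr deV) // ?xV // ?sUV // cyx.
  rewrite !(commbitC (v + x *+ e)) !(commbitDr deV) // ?sUV // !cyx.
  rewrite !assocE !(assocbitvv deV) // ?sUV // (commbitvv deV) //.
  rewrite (commbitC w v) (commbitC x v) (assocbitAC x w v).
  move: (commbit v w) (commbit v x) (commbit w x) (assocbit x v w).
  by case: e f => [] [] [] [] [] [].
have [pd ps pl pr pc] := phiP.
exists phi'; split.
- move=> _ /dec[v Uv [e ->]]; rewrite phiE // sq2 // pd // /ext.
  rewrite (assocbitC x) (assocbitAC v x) (assocbitvv deV) // ?sUV //.
  by rewrite andbF addbF andbA andbb addbA addbAC.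
- move=> _ _ /dec[v Uv [e ->]] /dec[w Uw [f ->]].
  rewrite !phiE // comm2 // ps // /ext (assocbitAC x w).
  move: (phi w v) (commbit v w) (commbit v x) (commbit w x) (assocbit x v w).
  by case: e f (sqbit x) => [] [] [] [] [] [] [] [].
- move=> _ /dec[v Uv [e ->]].
  have -> : 0 = 0 + x *+ false by rewrite addr0.
  rewrite phiE ?mem0v // pl // /ext commbit0 assocbitC assocbit0.
  by rewrite !andbF.
- move=> _ /dec[v Uv [e ->]].
  have -> : 0 = 0 + x *+ false by rewrite addr0.
  rewrite phiE ?mem0v // pr // /ext assocbitAC assocbitC assocbit0.
  by rewrite !andbF.
move=> _ _ _ /dec[u Uu [g ->]] /dec[v Uv [e ->]] /dec[w Uw [f ->]].
rewrite !xD !phiE ?memvD // pc // assoc3 //.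
rewrite (addbACA (phi v (w + u))) (addbACA (_ (+) phi v w)).
rewrite (addbACA (_ (+) phi w u)); congr (_ (+) _).
rewrite /ext (commbitDl deV) // ?sUV // !assocE.
rewrite (assocbitC v w x) (assocbitAC w v x) (assocbitC w x v).
rewrite (assocbitAC x w v).
move: (commbit v x) (commbit w x).
move: (assocbit x v u) (assocbit x w u) (assocbit x v w).
by case: e f g (sqbit x) => [] [] [] [] [] [] [] [] [].
Qed.

Lemma factor_on_exists X : doubly_even <<X>>%VS ->
  exists phi, factor_on <<X>>%VS phi.
Proof.
elim: X => [|x X IH] deX.
  exists (fun _ _ => false); split => //; rewrite ?span_nil.
  - by move=> v; rewrite memv0 => /eqP->; rewrite sqbit0.
  - by move=> v w; rewrite memv0 => /eqP-> _; rewrite commbit0.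
  - by move=> u v w _; rewrite memv0 => /eqP->; rewrite assocbit0.
have [|phi phiP] := IH; last exact: factor_on_cons phiP.
by move=> v Xv; apply: deX; rewrite span_cons -[v]add0r memv_add ?mem0v.
Qed.

Theorem code_loop_exists V : doubly_even V -> inhabited (code_loop V).
Proof.
move=> deV; have [|phi [pd ps pl pr pc]] := @factor_on_exists (vbasis V).
  by rewrite (span_basis (vbasisP V)).
rewrite (span_basis (vbasisP V)) in pd ps pl pr pc.
constructor; exists (fun v w => phi (vsval v) (vsval w)) => //; split.
- by move=> v; rewrite pd ?subvsP.
- by move=> v w; apply: ps; apply: subvsP.
- by move=> v; rewrite linear0 pl ?subvsP.
- by move=> v; rewrite linear0 pr ?subvsP.
by move=> u v w; rewrite !linearD pc ?subvsP.
Qed.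
End Existence.

(** * Squares, commutators and associators in a code loop *)

Section LoopInvariants.
Variables (m : nat) (V : {vspace 'rV['F_2]_m}) (L : code_loop V).
Implicit Types x y z : L.

Definition vec (x : L) : 'rV['F_2]_m := vsval x.2.

Lemma vecV x : vec x \in V. Proof. exact: subvsP. Qed.

Lemma cl_mulE x y :
  (x * y)%g = (x.1 (+) y.1 (+) cl_factor L x.2 y.2, x.2 + y.2).
Proof. by []. Qed.

Lemma cl_invE x : (x^-1)%g = (x.1 (+) cl_factor L x.2 x.2, x.2).
Proof. by []. Qed.

Lemma sign_mul e x : (cl_sign L e * x)%g = (odd e (+) x.1, x.2) :> L.
Proof. by rewrite cl_mulE /= (fs_0l (cl_factor_set L)) addbF add0r. Qed.

Lemma sign_mulK e x : (cl_sign L e * x * x^-1)%g = cl_sign L e.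
Proof.
rewrite sign_mul cl_mulE cl_invE /= subvs_addvv /cl_sign.
by case: x.1 (cl_factor _ _ _) (odd e) => [] [] [].
Qed.

Lemma cl_sign_eq e e' : cl_sign L e = cl_sign L e' <-> odd e = odd e'.
Proof. by split=> [[]|] //; rewrite /cl_sign => ->. Qed.

Lemma cl_sign_inj (b c : bool) : cl_sign L b = cl_sign L c -> b = c.
Proof. by move/cl_sign_eq; rewrite !oddb. Qed.

Lemma cl_squareE x : (x * x)%g = cl_sign L (sqbit (vec x)).
Proof.
rewrite cl_mulE (fs_diag (cl_factor_set L)) addbb addFb subvs_addvv.
by rewrite /cl_sign oddb.
Qed.

(** The next two rules express commutators and associators without inverses, so
    that multiplicative maps can be applied to them directly. *)
Lemma cl_swap x y :
  (x * y)%g = (cl_sign L (commbit (vec x) (vec y)) * (y * x))%g.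
Proof.
rewrite sign_mul !cl_mulE /= (fs_swap (cl_factor_set L)) oddb (addrC y.2).
by congr (_, _); rewrite addbCA (addbC x.1).
Qed.

Lemma cl_reassoc x y z : (x * y * z)%g
  = (cl_sign L (assocbit (vec x) (vec y) (vec z)) * (x * (y * z)))%g.
Proof.
rewrite sign_mul !cl_mulE /= (fs_cocycle (cl_factor_set L)) oddb addrA.
congr (_, _); rewrite -/(assocbit _ _ _) -/(vec x) -/(vec y) -/(vec z).
move: (assocbit _ _ _) (cl_factor _ _ _) (cl_factor _ _ _) (cl_factor _ _ _).
by case: x.1 y.1 z.1 => [] [] [] [] [] [] [].
Qed.

Lemma assocbit_nonassociative x y z :
  assocbit (vec x) (vec y) (vec z) -> nonassociative_loop L.
Proof.
move=> xyz LA; have := cl_reassoc x y z; rewrite xyz -LA sign_mul.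
by move/(congr1 fst) => /=; case: (_ (+) _).
Qed.

Lemma cl_associatorE x y z :
  associator x y z = cl_sign L (assocbit (vec x) (vec y) (vec z)).
Proof.
by rewrite /associator (cl_reassoc x y z) sign_mulK.
Qed.

Lemma cl_commE x y : [~ x, y]%g = cl_sign L (commbit (vec x) (vec y)).
Proof.
pose F := cl_factor L; have FP := cl_factor_set L.
have Fyx : F y.2 (x.2 + y.2) = F y.2 y.2 (+) F y.2 x.2.
  have := fs_cocycle FP x.2 y.2 y.2.
  rewrite subvs_addvv (fs_0l FP) setIid.
  rewrite (negbTE (even_suppI (cl_doubly_even L) (vecV y) (vecV x))) addbF.
  rewrite (addrC x.2) -/F.
  by case: (F _ _) (F _ _) (F _ _) => [] [] [].
have yxy : y.2 + (x.2 + y.2) = x.2 by rewrite addrCA subvs_addvv addr0.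
rewrite /commg /conjg !(cl_mulE, cl_invE) /= -!/F Fyx yxy subvs_addvv.
rewrite [F x.2 y.2](fs_swap FP) -/F -/(vec x) -/(vec y) /cl_sign oddb.
rewrite -/(commbit _ _); congr (_, _).
move: (commbit _ _) (F _ _) (F _ _) (F _ _).
by case: x.1 y.1 => [] [] [] [] [] [].
Qed.

Lemma sign_cancel e x y : (x * y)%g = (cl_sign L e * y)%g -> x = cl_sign L e.
Proof.
case: x => s v; rewrite sign_mul cl_mulE /= => -[].
move=> + /(canRL (addrK _)); rewrite subrr => + v0.
rewrite v0 (fs_0l (cl_factor_set L)) addbF => /addIb ->.
by rewrite /cl_sign.
Qed.

End LoopInvariants.

(** * Isomorphisms of nonassociative code loops preserve the invariants *)

Section Isomorphism.
Variables (m n : nat) (V : {vspace 'rV['F_2]_m}) (W : {vspace 'rV['F_2]_n}).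
Variables (L : code_loop V) (M : code_loop W) (f : {multiplicative L -> M}).
Hypothesis f_inj : injective f.
Variables a b c : L.
Hypothesis abc : assocbit (vec a) (vec b) (vec c).

(** As f(1) is its own square, it is a sign; so its vector is 0, and squares over
    the zero vector are 1. *)
Lemma iso_one : f (cl_sign L 0) = cl_sign M 0.
Proof.
have f1 := congr1 f (cl_mul1x (cl_sign L 0)).
rewrite gmulfM cl_squareE in f1.
have v0 : vec (f (cl_sign L 0)) = 0 by rewrite -f1.
by rewrite -f1 v0 sqbit0.
Qed.

(** Comparing the image of the relation (ab)c = -(a(bc)) with the relation
    between the images shows that f(-1) is an associator, hence a sign; it is
    not 1 by injectivity. *)
Lemma iso_minus_one : f (cl_sign L 1) = cl_sign M 1.
Proof.
have := congr1 f (cl_reassoc a b c).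
rewrite abc !gmulfM (cl_reassoc (f a) (f b) (f c)) => /esym/sign_cancel.
case: (assocbit _ _ _) => // f_eq1.
by have := f_inj (etrans f_eq1 (esym iso_one)) => -[].
Qed.

Lemma iso_sign (e : bool) : f (cl_sign L e) = cl_sign M e.
Proof. by case: e; [apply: iso_minus_one | apply: iso_one]. Qed.

Lemma iso_sqbit x : sqbit (vec (f x)) = sqbit (vec x).
Proof.
apply/(@cl_sign_inj _ _ M).
by rewrite -cl_squareE -gmulfM cl_squareE iso_sign.
Qed.

Lemma iso_commbit x y :
  commbit (vec (f x)) (vec (f y)) = commbit (vec x) (vec y).
Proof.
have := congr1 f (cl_swap x y).
rewrite !gmulfM iso_sign (cl_swap (f x)).
by move=> /sign_cancel/cl_sign_inj.
Qed.

Lemma iso_assocbit x y z :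
  assocbit (vec (f x)) (vec (f y)) (vec (f z))
  = assocbit (vec x) (vec y) (vec z).
Proof.
have := congr1 f (cl_reassoc x y z).
rewrite !gmulfM iso_sign (cl_reassoc (f x)).
by move=> /sign_cancel/cl_sign_inj.
Qed.

Lemma iso_vec_eq0 x : vec (f x) = 0 -> vec x = 0.
Proof.
move=> fx0; suff [e ->] : exists e : bool, x = cl_sign L e by [].
exists (f x).1; apply: f_inj; rewrite iso_sign.
move: fx0; case: (f x) => s v; rewrite /vec /cl_sign oddb /= => v0.
by congr (_, _); apply/val_inj.
Qed.

End Isomorphism.

(** * Characteristic vectors in terms of the code *)

Section CharacteristicVectors.
Variables (m : nat) (lam : 10.-tuple 'F_2).
Implicit Types (V : {vspace 'rV['F_2]_m}) (a b c d : 'rV['F_2]_m).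

Definition lambda_bit (j : nat) : bool := odd (nth 0 lam j.-1 : 'F_2).

Definition has_char a b c d : Prop :=
  [/\ [/\ assocbit a b c, assocbit a b d = false, assocbit a c d = false
        & assocbit b c d = false],
      [/\ sqbit a = lambda_bit 1, sqbit b = lambda_bit 2,
          sqbit c = lambda_bit 3 & sqbit d = lambda_bit 4],
      [/\ commbit a b = lambda_bit 5, commbit a c = lambda_bit 6
        & commbit a d = lambda_bit 7]
    & [/\ commbit b c = lambda_bit 8, commbit b d = lambda_bit 9
        & commbit c d = lambda_bit 10]].

(** Generating the loop amounts to spanning the code: -1 is the associator of
    [a], [b], [c], so a subloop containing these elements contains both
    elements above each vector that it reaches. *)
Lemma is_char_vectorP V (L : code_loop V) (a b c d : L) :
  is_char_vector lam a b c d <->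
  V = <<[:: vec a; vec b; vec c; vec d]>>%VS
  /\ has_char (vec a) (vec b) (vec c) (vec d).
Proof.
set X := [:: vec a; vec b; vec c; vec d].
have sgnE (e : bool) k : cl_sign L e = cl_sign L k <-> e = odd k.
  by rewrite cl_sign_eq oddb.
have XV : (<<X>> <= V)%VS.
  by apply/span_subvP => x; rewrite !inE => /or4P[] /eqP->; apply: vecV.
split.
  case=> gen [abc abd acd bcd] [a2 b2 c2 d2] [ab ac ad] [bc bd cd].
  rewrite !cl_associatorE in abc abd acd bcd.
  rewrite !cl_commE in ab ac ad bc bd cd.
  rewrite !expg2 !cl_squareE in a2 b2 c2 d2.
  split; last first.
    split; split; try exact/sgnE; try exact/(sgnE _ 0%N).
    by apply/(sgnE _ 1%N).
  apply/eqP; rewrite eqEsubv XV andbT; apply/subvP => v Vv.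
  have /= := gen [pred x : L | vec x \in <<X>>%VS] _ _ _ _ (false, vsproj V v).
  rewrite !inE /vec vsprojK //; apply; rewrite ?mem0v //.
  - by move=> x y; rewrite !inE => Xx Xy; rewrite memvD.
  - move=> x; rewrite !inE => /or4P[] /eqP->; apply: memv_span;
      by rewrite !inE eqxx ?orbT.
move=> [VE [[abc abd acd bcd] [a2 b2 c2 d2] [ab ac ad] [bc bd cd]]].
split; [move=> S S1 SM SI sS | split | split | split | split];
  rewrite ?cl_associatorE ?cl_commE ?expg2 ?cl_squareE; try exact/sgnE;
  try exact/(sgnE _ 0%N); try by apply/(sgnE _ 1%N).
have /and5P[Sa Sb Sc Sd _] : all [in S] [:: a; b; c; d] by apply/allP.
have SN : cl_sign L 1 \in S.
  have <- : associator a b c = cl_sign L 1 by rewrite cl_associatorE abc.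
  by apply: (SM); [|apply: (SI)]; do ?apply: (SM).
suff S_span : {in <<X>>%VS, forall v s (u : subvs_of V), vsval u = v ->
    ((s, u) : L) \in S}.
  by case=> s u; apply: (S_span (vsval u)); rewrite // /X -VE subvsP.
apply: span2_ind => [s u u0|x v Xx Xv IH s u uE].
  have -> : (s, u) = cl_sign L s.
    by rewrite /cl_sign oddb (_ : u = 0) //; apply/val_inj.
  by case: s.
have [y Sy yE] : exists2 y : L, y \in S & vec y = x.
  move: Xx; rewrite !inE.
  by case/or4P=> /eqP->; [exists a | exists b | exists c | exists d].
have Vv : v \in V by apply: (subvP XV).
pose u' := vsproj V v.
(* The sign of the second factor is chosen so that the product has sign [s]. *)
have := SM y (y.1 (+) s (+) cl_factor L y.2 u', u') Sy (IH _ _ (vsprojK Vv)).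
rewrite cl_mulE /=; congr (_ \in S); congr (_, _); last first.
  by apply/val_inj; rewrite /= vsprojK // uE -yE.
by case: y.1 s (cl_factor _ _ _) => [] [] [].
Qed.

End CharacteristicVectors.

Section CharBasis.
Variables (m : nat) (lam : 10.-tuple 'F_2) (V : {vspace 'rV['F_2]_m}).
Variables a b c d : 'rV['F_2]_m.
Hypothesis deV : doubly_even V.
Hypotheses (Va : a \in V) (Vb : b \in V) (Vc : c \in V) (Vd : d \in V).
Hypothesis abcdP : has_char lam a b c d.

(** The linear forms assocbit(_, b, c), assocbit(_, a, c) and assocbit(_, a, b)
    vanish on [d] and are dual to [a], [b], [c], so [d] is the only generator
    whose independence has to be assumed. *)
Lemma has_char_free : d != 0 -> free [:: a; b; c; d].
Proof.
move=> d0; have [[abc abd acd bcd] _ _ _] := abcdP.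
have sep (Y : seq 'rV['F_2]_m) x u v :
    {in Y, forall y, assocbit y u v = false} -> assocbit x u v ->
    x \notin <<Y>>%VS.
  move=> Yuv xuv; suff spanY : {in <<Y>>%VS, forall y, assocbit y u v = false}.
    by apply/negP => /spanY; rewrite xuv.
  apply: span2_ind => [|y w Yy _ wuv]; first exact: assocbit0.
  by rewrite assocbitDl Yuv // wuv.
rewrite !free_cons nil_free andbT span_nil memv0 d0 andbT.
apply/and3P; split.
- apply: sep abc => y; rewrite !inE => /or3P[] /eqP->.
  + exact: (assocbitvv deV).
  + by rewrite assocbitAC (assocbitvv deV).
  + by rewrite assocbitC assocbitAC.
- have bac : assocbit b a c by rewrite assocbitC.
  apply: sep bac => y; rewrite !inE => /orP[] /eqP->.
  + by rewrite assocbitAC (assocbitvv deV).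
  + by rewrite assocbitC assocbitAC.
- have cab : assocbit c a b by rewrite assocbitC assocbitAC.
  apply: sep cab => y; rewrite !inE => /eqP->.
  by rewrite assocbitC assocbitAC.
Qed.

Definition comm_table (i j : nat) : bool :=
  let l := lambda_bit lam in
  nth false (nth [::] [:: [:: false; l 5; l 6; l 7];
                          [:: l 5; false; l 8; l 9];
                          [:: l 6; l 8; false; l 10];
                          [:: l 7; l 9; l 10; false]] i) j.

Lemma has_char_sqbit i : (i < 4)%N ->
  sqbit [:: a; b; c; d]`_i = lambda_bit lam i.+1.
Proof. by have [_ [? ? ? ?] _ _] := abcdP; case: i => [|[|[|[|]]]]. Qed.

Lemma has_char_commbit i j : (i < 4)%N -> (j < 4)%N ->
  commbit [:: a; b; c; d]`_i [:: a; b; c; d]`_j = comm_table i j.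
Proof.
have [_ _ [? ? ?] [? ? ?]] := abcdP.
by case: i => [|[|[|[|]]]] //; case: j => [|[|[|[|]]]] //= _ _;
  rewrite ?(commbitvv deV) // commbitC.
Qed.

Lemma has_char_assocbit i j k : (i < 4)%N -> (j < 4)%N -> (k < 4)%N ->
  assocbit [:: a; b; c; d]`_i [:: a; b; c; d]`_j [:: a; b; c; d]`_k
  = perm_eq [:: i; j; k] [:: 0; 1; 2]%N.
Proof.
have [[abc abd acd bcd] _ _ _] := abcdP.
have perm3 (u v w : 'rV['F_2]_m) e : assocbit u v w = e ->
    [/\ assocbit u w v = e, assocbit v u w = e, assocbit v w u = e,
        assocbit w u v = e & assocbit w v u = e].
  move=> <-; split; first by rewrite assocbitAC.
  - by rewrite assocbitC.
  - by rewrite assocbitAC assocbitC.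
  - by rewrite assocbitC assocbitAC.
  - by rewrite assocbitAC assocbitC assocbitAC.
have [? ? ? ? ?] := perm3 _ _ _ _ abc; have [? ? ? ? ?] := perm3 _ _ _ _ abd.
have [? ? ? ? ?] := perm3 _ _ _ _ acd; have [? ? ? ? ?] := perm3 _ _ _ _ bcd.
have vv (x y : 'rV['F_2]_m) : x \in V -> y \in V ->
    [/\ assocbit x x y = false, assocbit x y x = false
      & assocbit y x x = false].
  move=> Vx Vy; split; first exact: (assocbitvv deV).
  - by rewrite assocbitAC (assocbitvv deV).
  - by rewrite assocbitC assocbitAC (assocbitvv deV).
have [? _ _] := vv _ _ Va Va; have [? _ _] := vv _ _ Vb Vb.
have [? _ _] := vv _ _ Vc Vc; have [? _ _] := vv _ _ Vd Vd.
have [? ? ?] := vv _ _ Va Vb; have [? ? ?] := vv _ _ Vb Va.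
have [? ? ?] := vv _ _ Va Vc; have [? ? ?] := vv _ _ Vc Va.
have [? ? ?] := vv _ _ Va Vd; have [? ? ?] := vv _ _ Vd Va.
have [? ? ?] := vv _ _ Vb Vc; have [? ? ?] := vv _ _ Vc Vb.
have [? ? ?] := vv _ _ Vb Vd; have [? ? ?] := vv _ _ Vd Vb.
have [? ? ?] := vv _ _ Vc Vd; have [? ? ?] := vv _ _ Vd Vc.
by case: i => [|[|[|[|//]]]] _; case: j => [|[|[|[|//]]]] _;
  case: k => [|[|[|[|//]]]] _.
Qed.

End CharBasis.

(** * Transport of a factor set along a bijection preserving the invariants *)

Section Transport.
Variables (m n : nat) (V : {vspace 'rV['F_2]_m}) (W : {vspace 'rV['F_2]_n}).
Variables (L : code_loop W).
Variable g : {linear 'rV['F_2]_m -> 'rV['F_2]_n}.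
Variable h : {linear 'rV['F_2]_n -> 'rV['F_2]_m}.
Hypothesis deV : doubly_even V.
Hypothesis gW : {in V, forall v, g v \in W}.
Hypothesis hV : {in W, forall w, h w \in V}.
Hypotheses (ghK : {in W, cancel h g}) (hgK : {in V, cancel g h}).
Hypothesis g_sq : {in V, forall v, sqbit (g v) = sqbit v}.
Hypothesis g_comm : {in V &, forall v w, commbit (g v) (g w) = commbit v w}.
Hypothesis g_assoc :
  {in V & &, forall u v w, assocbit (g u) (g v) (g w) = assocbit u v w}.

(** The conditions on a factor set mention the code only through the three
    invariants, so the factor set of [L] composed with [g] is one for [V], and
    the loop that it defines is [L] itself with relabelled vectors. *)
Lemma transport_representation : representation L V.
Proof.
pose G (v : subvs_of V) : subvs_of W := vsproj W (g (vsval v)).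
pose H (w : subvs_of W) : subvs_of V := vsproj V (h (vsval w)).
have GE v : vsval (G v) = g (vsval v) by rewrite vsprojK // gW ?subvsP.
have HE w : vsval (H w) = h (vsval w) by rewrite vsprojK // hV ?subvsP.
have GH : cancel H G by move=> w; apply/val_inj; rewrite /= GE HE ghK ?subvsP.
have HG : cancel G H by move=> v; apply/val_inj; rewrite /= HE GE hgK ?subvsP.
have GD v w : G (v + w) = G v + G w.
  by apply/val_inj; rewrite /= GE !linearD !GE.
have G0 : G 0 = 0 by apply/val_inj; rewrite /= GE !linear0.
have HD v w : H (v + w) = H v + H w by apply: (can_inj HG); rewrite GD !GH.
pose psi v w := cl_factor L (G v) (G w).
have psiP : factor_set psi.
  have FP := cl_factor_set L; rewrite /psi; split.
  - by move=> v; rewrite (fs_diag FP) GE; apply: g_sq; apply: subvsP.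
  - move=> v w; rewrite (fs_swap FP) !GE; congr (_ (+) _).
    by apply: g_comm; apply: subvsP.
  - by move=> v; rewrite G0 (fs_0l FP).
  - by move=> v; rewrite G0 (fs_0r FP).
  - move=> u v w; rewrite !GD (fs_cocycle FP) !GE; congr (_ (+) _).
    by apply: g_assoc; apply: subvsP.
pose M := CodeLoop deV psiP; exists M.
pose f (x : L) : M := (x.1, H x.2).
have fM : {morph f : x y / (x * y)%g}.
  by move=> x y; rewrite !cl_mulE /f /= HD /psi !GH.
pose F : {multiplicative L -> M} :=
  HB.pack f (isMultiplicative.Build _ _ f fM).
exists F; exists (fun x : M => (x.1, G x.2) : L) => -[s v]; congr (_, _).
  exact: GH.
exact: HG.
Qed.

End Transport.

Theorem same_invariants_representation m n
    (W : {vspace 'rV['F_2]_n}) (L : code_loop W)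
    (X : seq 'rV['F_2]_n) (Y : seq 'rV['F_2]_m) :
  W = <<X>>%VS -> doubly_even <<Y>>%VS -> free X -> free Y ->
  size X = size Y ->
  (forall i, (i < size Y)%N -> sqbit X`_i = sqbit Y`_i) ->
  (forall i j, (i < size Y)%N -> (j < size Y)%N ->
     commbit X`_i X`_j = commbit Y`_i Y`_j) ->
  (forall i j k, (i < size Y)%N -> (j < size Y)%N -> (k < size Y)%N ->
     assocbit X`_i X`_j X`_k = assocbit Y`_i Y`_j Y`_k) ->
  representation L <<Y>>%VS.
Proof.
move=> WE deY fX fY sXY sq cm asc.
have deW := cl_doubly_even L.
have [g /(_ fY sXY) gE] := linear_of_free Y X.
have [h /(_ fX (esym sXY)) hE] := linear_of_free X Y.
have gi i : (i < size Y)%N -> g Y`_i = X`_i.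
  by move=> lt_i; rewrite -gE (nth_map 0).
have hi i : (i < size Y)%N -> h X`_i = Y`_i.
  by move=> lt_i; rewrite -hE (nth_map 0) // sXY.
have Yi y : y \in Y -> exists2 i, (i < size Y)%N & y = Y`_i.
  by case/(nthP 0) => i lt_i <-; exists i.
have gY : {in Y, forall y, g y \in W}.
  by move=> _ /Yi[i lt_i ->]; rewrite gi // WE memv_span // mem_nth // sXY.
have gsq : {in Y, forall y, sqbit (g y) = sqbit y}.
  by move=> _ /Yi[i lt_i ->]; rewrite gi // sq.
have gcm : {in Y &, forall y z, commbit (g y) (g z) = commbit y z}.
  by move=> _ _ /Yi[i lt_i ->] /Yi[j lt_j ->]; rewrite !gi // cm.
have gasc : {in Y & &, forall x y z,
    assocbit (g x) (g y) (g z) = assocbit x y z}.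
  move=> _ _ _ /Yi[i lt_i ->] /Yi[j lt_j ->] /Yi[k lt_k ->].
  by rewrite !gi // asc.
apply: (@transport_representation _ _ _ _ L g h) => //.
- exact: span_image gY.
- rewrite WE; apply: span_image => _ /(nthP 0)[i lt_i <-].
  by rewrite hi -?sXY // memv_span // mem_nth -?sXY.
- rewrite WE; apply: span2_ind => [|x v /(nthP 0)[i lt_i <-] _ IH].
    by rewrite !linear0.
  by rewrite !linearD IH hi -?sXY // gi -?sXY.
- apply: span2_ind => [|x v /Yi[i lt_i ->] _ IH]; first by rewrite !linear0.
  by rewrite !linearD IH gi // hi.
- exact: span_same_sqbit deY deW gY gsq gcm gasc.
- exact: span_same_commbit deY deW gY gcm gasc.
- exact: span_same_assocbit gasc.
Qed.

(** * Lower bound for the length of a representation *)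

(** A cell collects the coordinates that lie in the same ones of the four
    generators [a], [b], [c], [d]. *)
Definition cell : Type := (bool * bool * bool * bool)%type.
Definition cells : seq cell :=
  let bits := [:: true; false] in
  let ab := [seq (a, b) | a <- bits, b <- bits] in
  let abc := [seq (p, c) | p <- ab, c <- bits] in
  [seq (p, d) | p <- abc, d <- bits].

Definition inA (p : cell) := p.1.1.1.
Definition inB (p : cell) := p.1.1.2.
Definition inC (p : cell) := p.1.2.
Definition inD (p : cell) := p.2.
Definition covered (p : cell) := [|| inA p, inB p, inC p | inD p].

(** A list sum rather than a big operator, so that it evaluates. *)
Definition total (n : cell -> nat) (P : pred cell) : nat :=
  sumn [seq n p | p <- cells & P p].

Lemma totalE n P : total n P = (\sum_(p <- cells | P p) n p)%N.
Proof. by rewrite /total sumnE big_map big_filter. Qed.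

Lemma total_sum n P : total n P = (\sum_(p : cell | P p) n p)%N.
Proof.
rewrite totalE; apply: perm_big; apply: uniq_perm => //.
  exact: index_enum_uniq.
by move=> [[[a b] c] d]; rewrite mem_index_enum; case: a b c d => [] [] [] [].
Qed.

Section CellCounts.
Variables (m : nat) (a b c d : 'rV['F_2]_m).

Definition cell_of (j : 'I_m) : cell :=
  (a 0 j != 0, b 0 j != 0, c 0 j != 0, d 0 j != 0).
Definition cell_card (p : cell) : nat := #|[set j | cell_of j == p]|.

Lemma card_cells (P : pred cell) :
  #|[set j | P (cell_of j)]| = total cell_card P.
Proof.
rewrite total_sum -sum1_card (partition_big cell_of P) => [|j];
  last by rewrite inE.
apply: eq_bigr => p Pp; rewrite /cell_card -sum1_card; apply: eq_bigl => j.
by rewrite !inE; case: eqP => [->|]; rewrite ?Pp ?andbF.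
Qed.

End CellCounts.

Section LengthBound.
Local Open Scope nat_scope.
Variable l : nat -> bool.

(** Inclusion-exclusion modulo 4, from the smallest intersections to the
    largest; a factor 3 stands for -1.  Here [t] is the size of the fourfold
    intersection modulo 4, and [u], [v], [w], [z] are the second binary digits
    of the triple intersections, whose first digits are [true] for [a], [b],
    [c] and [false] otherwise.  Double intersections are [2 * l j] modulo 4 and
    weights are 0 modulo 4. *)
Definition cell_residue (t u v w z : nat) (p : cell) : nat :=
  let abc := (true + 2 * u + 3 * t) %% 4 in
  let abd := (false + 2 * v + 3 * t) %% 4 in
  let acd := (false + 2 * w + 3 * t) %% 4 in
  let bcd := (false + 2 * z + 3 * t) %% 4 in
  let ab := (2 * l 5 + 3 * (abc + abd + t)) %% 4 in
  let ac := (2 * l 6 + 3 * (abc + acd + t)) %% 4 in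
  let ad := (2 * l 7 + 3 * (abd + acd + t)) %% 4 in
  let bc := (2 * l 8 + 3 * (abc + bcd + t)) %% 4 in
  let bd := (2 * l 9 + 3 * (abd + bcd + t)) %% 4 in
  let cd := (2 * l 10 + 3 * (acd + bcd + t)) %% 4 in
  match p with
  | (true, true, true, true) => t
  | (true, true, true, false) => abc
  | (true, true, false, true) => abd
  | (true, false, true, true) => acd
  | (false, true, true, true) => bcd
  | (true, true, false, false) => ab
  | (true, false, true, false) => ac
  | (true, false, false, true) => ad
  | (false, true, true, false) => bc
  | (false, true, false, true) => bd
  | (false, false, true, true) => cd
  | (true, false, false, false) =>
      (0 + 3 * (ab + ac + ad + abc + abd + acd + t)) %% 4
  | (false, true, false, false) =>
      (0 + 3 * (ab + bc + bd + abc + abd + bcd + t)) %% 4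
  | (false, false, true, false) =>
      (0 + 3 * (ac + bc + cd + abc + acd + bcd + t)) %% 4
  | (false, false, false, true) =>
      (0 + 3 * (ad + bd + cd + abd + acd + bcd + t)) %% 4
  | (false, false, false, false) => 0
  end%N.

Definition weights_ok (n : cell -> nat) : bool :=
  [&& total n inA %% 8 == 4 * l 1, total n inB %% 8 == 4 * l 2,
      total n inC %% 8 == 4 * l 3 & total n inD %% 8 == 4 * l 4]%N.

(** Both members bound the length of a code whose cell sizes are [r] modulo 4.
    In the first, if [r] violates the conditions modulo 8, the cell sizes are not
    [r] itself, so they exceed it by at least 4 in total.  In the second, the
    cells inside [d] add up to the weight of [d], which is positive and
    congruent to [4 * l 4] modulo 8; it is the better one for short codes in
    which [d] would be 0, such as the Hamming code of length 7 for C_1. *)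
Definition residue_bound (r : cell -> nat) : nat :=
  maxn (total r covered + (if weights_ok r then 0 else 4))
       (total r (fun p => covered p && ~~ inD p) + (if l 4 then 4 else 8)).

Definition length_bound (M : nat) : bool :=
  all (fun t => all (fun u => all (fun v => all (fun w => all (fun z =>
    M <= residue_bound (cell_residue t u v w z))
    (iota 0 2)) (iota 0 2)) (iota 0 2)) (iota 0 2)) (iota 0 4).

Lemma total_split (n r k : cell -> nat) (P : pred cell) :
  (forall p, P p -> n p = r p + 4 * k p)%N ->
  total n P = (total r P + 4 * total k P)%N.
Proof.
by move=> nE; rewrite !totalE big_distrr -big_split; apply: eq_bigr.
Qed.

Lemma total_le n (P Q : pred cell) : subpred P Q -> (total n P <= total n Q)%N.
Proof.
move=> sPQ; rewrite !totalE [X in (X <= _)%N]big_mkcond.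
rewrite [X in (_ <= X)%N]big_mkcond.
by apply: leq_sum => p _; case: ifP => // /sPQ->.
Qed.

(** If x + t has parity [e] and second binary digit q, then x is congruent to
    e + 2 q - t modulo 4. *)
Lemma top_mod4 x t (e : bool) : odd (x + t) = e ->
  (e + 2 * ((x + t) %/ 2 %% 2) + 3 * (t %% 4)) %% 4 = x %% 4.
Proof. by case: e => /=; lia. Qed.

Lemma sub_mod4 s x r r' y : s %% 4 = y -> s = x + r -> r = r' %[mod 4] ->
  (y + 3 * r') %% 4 = x %% 4.
Proof. by move=> <- ->; lia. Qed.

(** The five parameters are read off the cells themselves; all other cells
    follow by solving the conditions from the top down. *)
Lemma cell_residueP (n : cell -> nat) : weights_ok n ->
  [/\ total n (fun p => inA p && inB p) %% 4 = 2 * l 5,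
      total n (fun p => inA p && inC p) %% 4 = 2 * l 6
    & total n (fun p => inA p && inD p) %% 4 = 2 * l 7]%N ->
  [/\ total n (fun p => inB p && inC p) %% 4 = 2 * l 8,
      total n (fun p => inB p && inD p) %% 4 = 2 * l 9
    & total n (fun p => inC p && inD p) %% 4 = 2 * l 10]%N ->
  [/\ odd (total n (fun p => [&& inA p, inB p & inC p])),
      ~~ odd (total n (fun p => [&& inA p, inB p & inD p])),
      ~~ odd (total n (fun p => [&& inA p, inC p & inD p]))
    & ~~ odd (total n (fun p => [&& inB p, inC p & inD p]))] ->
  exists t u v w z : nat, [/\ t < 4, [/\ u < 2, v < 2, w < 2 & z < 2]
    & forall p, covered p -> n p %% 4 = cell_residue t u v w z p]%N.
Proof.
rewrite /weights_ok /total /=.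
set t := n (true, true, true, true).
set abc := n (true, true, true, false); set abd := n (true, true, false, true).
set acd := n (true, false, true, true); set bcd := n (false, true, true, true).
set ab := n (true, true, false, false); set ac := n (true, false, true, false).
set ad := n (true, false, false, true); set bc := n (false, true, true, false).
set bd := n (false, true, false, true); set cd := n (false, false, true, true).
set a := n (true, false, false, false); set b := n (false, true, false, false).
set c := n (false, false, true, false); set d := n (false, false, false, true).
move=> /and4P[/eqP a8 /eqP b8 /eqP c8 /eqP d8] [ab4 ac4 ad4] [bc4 bd4 cd4].
move=> [abc2 abd2 acd2 bcd2].
exists (t %% 4)%N, ((abc + t) %/ 2 %% 2)%N, ((abd + t) %/ 2 %% 2)%N,
  ((acd + t) %/ 2 %% 2)%N, ((bcd + t) %/ 2 %% 2)%N.
split; first exact: ltn_pmod.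
  by split; apply: ltn_pmod.
have mod84 k (e : bool) : k %% 8 = 4 * e -> k %% 4 = 0 by clear; lia.
have [a4 b4] := (mod84 _ _ a8, mod84 _ _ b8).
have [c4 d4] := (mod84 _ _ c8, mod84 _ _ d8).
move=> p; rewrite /cell_residue.
have odd2 x e : odd (t + (x + 0)) = e -> odd (x + t) = e by rewrite addn0 addnC.
rewrite (top_mod4 (odd2 _ true abc2)).
rewrite (top_mod4 (odd2 _ _ (negbTE abd2))).
rewrite (top_mod4 (odd2 _ _ (negbTE acd2))).
rewrite (top_mod4 (odd2 _ _ (negbTE bcd2))).
rewrite (sub_mod4 (x := ab) (r := abc + abd + t) ab4); [|clear; lia..].
rewrite (sub_mod4 (x := ac) (r := abc + acd + t) ac4); [|clear; lia..].
rewrite (sub_mod4 (x := ad) (r := abd + acd + t) ad4); [|clear; lia..].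
rewrite (sub_mod4 (x := bc) (r := abc + bcd + t) bc4); [|clear; lia..].
rewrite (sub_mod4 (x := bd) (r := abd + bcd + t) bd4); [|clear; lia..].
rewrite (sub_mod4 (x := cd) (r := acd + bcd + t) cd4); [|clear; lia..].
rewrite (sub_mod4 (x := a) (r := ab + ac + ad + abc + abd + acd + t) a4);
  [|clear; lia..].
rewrite (sub_mod4 (x := b) (r := ab + bc + bd + abc + abd + bcd + t) b4);
  [|clear; lia..].
rewrite (sub_mod4 (x := c) (r := ac + bc + cd + abc + acd + bcd + t) c4);
  [|clear; lia..].
rewrite (sub_mod4 (x := d) (r := ad + bd + cd + abd + acd + bcd + t) d4);
  [|clear; lia..].
by case: p => [[[[] []] []] []].
Qed.

Lemma residue_boundP (n r : cell -> nat) : weights_ok n ->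
  (0 < total n inD)%N -> (forall p, covered p -> n p %% 4 = r p)%N ->
  (residue_bound r <= total n covered)%N.
Proof.
move=> nok nD nr; pose k p := (n p %/ 4)%N.
have nE p : covered p -> n p = (r p + 4 * k p)%N.
  by move=> /nr <-; rewrite /k {1}(divn_eq (n p) 4) mulnC addnC.
have nE' (P : pred cell) :
    subpred P covered -> total n P = (total r P + 4 * total k P)%N.
  by move=> sP; apply: total_split => p /sP/nE.
have [sA sB sC sD] : [/\ subpred inA covered, subpred inB covered,
    subpred inC covered & subpred inD covered].
  by split=> p; rewrite /covered => ->; rewrite ?orbT.
rewrite geq_max; apply/andP; split.
  rewrite (nE' covered) // leq_add2l; case: ifP => // rok.
  case k0: (total k covered) => [|//]; last by lia.
  have kP (P : pred cell) : subpred P covered -> total k P = 0%N.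
    by move=> /(total_le k); rewrite k0 leqn0 => /eqP.
  move: nok; rewrite /weights_ok !nE' // !kP // !addn0.
  by rewrite -/(weights_ok r) rok.
pose offD p := covered p && ~~ inD p.
have -> : total n covered = (total n offD + total n inD)%N.
  rewrite !totalE (bigID inD) addnC; congr (_ + _)%N; apply: eq_bigl => p.
  by rewrite andbC; case: inD (sD p) => //= ->.
apply: leq_add; first by rewrite (nE' offD) ?leq_addr // => p /andP[].
case/and4P: nok => _ _ _ /eqP.
by case: (l 4); move: nD; move: (total _ _) => x; lia.
Qed.

Lemma length_boundP (n : cell -> nat) M : length_bound M ->
  weights_ok n -> (0 < total n inD)%N ->
  [/\ total n (fun p => inA p && inB p) %% 4 = 2 * l 5,
      total n (fun p => inA p && inC p) %% 4 = 2 * l 6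
    & total n (fun p => inA p && inD p) %% 4 = 2 * l 7]%N ->
  [/\ total n (fun p => inB p && inC p) %% 4 = 2 * l 8,
      total n (fun p => inB p && inD p) %% 4 = 2 * l 9
    & total n (fun p => inC p && inD p) %% 4 = 2 * l 10]%N ->
  [/\ odd (total n (fun p => [&& inA p, inB p & inC p])),
      ~~ odd (total n (fun p => [&& inA p, inB p & inD p])),
      ~~ odd (total n (fun p => [&& inA p, inC p & inD p]))
    & ~~ odd (total n (fun p => [&& inB p, inC p & inD p]))] ->
  (M <= total n covered)%N.
Proof.
move=> ok nok nD abP cdP abcP.
have [t [u [v [w [z [lt_t [lt_u lt_v lt_w lt_z] nr]]]]]] :=
  cell_residueP nok abP cdP abcP.
apply: leq_trans (residue_boundP nok nD nr).
move: ok => /allP/(_ t) /[!mem_iota] /(_ lt_t).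
move=> /allP/(_ u) /[!mem_iota] /(_ lt_u).
move=> /allP/(_ v) /[!mem_iota] /(_ lt_v) /allP/(_ w) /[!mem_iota] /(_ lt_w).
by move=> /allP/(_ z) /[!mem_iota] /(_ lt_z).
Qed.

End LengthBound.

Lemma modn_odd_divn d k :
  (0 < d -> d %| k -> k %% (d * 2) = d * odd (k %/ d))%N.
Proof.
move=> d_gt0 /dvdnP[q ->].
by rewrite mulnK // mulnC -muln_modr modn2.
Qed.

Theorem has_char_length m (lam : 10.-tuple 'F_2) (V : {vspace 'rV['F_2]_m})
    a b c d M :
  doubly_even V -> a \in V -> b \in V -> c \in V -> d \in V ->
  has_char lam a b c d -> d != 0 ->
  length_bound (lambda_bit lam) M -> (M <= m)%N.
Proof.
move=> deV Va Vb Vc Vd.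
move=> [[abc abd acd bcd] [a2 b2 c2 d2] [ab ac ad] [bc bd cd]] d0 ok.
pose n := cell_card a b c d.
have tE (P : pred cell) (A : {set 'I_m}) :
    (forall j, (j \in A) = P (cell_of a b c d j)) -> total n P = #|A|.
  by move=> AE; rewrite -card_cells; apply: eq_card => j; rewrite AE inE.
have tA : total n inA = #|supp a| by apply: tE => j; rewrite inE.
have tB : total n inB = #|supp b| by apply: tE => j; rewrite inE.
have tC : total n inC = #|supp c| by apply: tE => j; rewrite inE.
have tD : total n inD = #|supp d| by apply: tE => j; rewrite inE.
have w8 x (e : bool) : x \in V -> sqbit x = e -> (#|supp x| %% 8 = 4 * e)%N.
  by move=> /deV x4 <-; rewrite (@modn_odd_divn 4).
have i4 P x y (e : bool) :
    (forall j, (j \in supp x :&: supp y) = P (cell_of a b c d j)) ->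
    x \in V -> y \in V -> commbit x y = e -> (total n P %% 4 = 2 * e)%N.
  move=> /tE-> Vx Vy <-.
  by rewrite (@modn_odd_divn 2) // dvdn2 (even_suppI deV).
have i2 P x y z (e : bool) :
    (forall j, (j \in supp x :&: supp y :&: supp z) = P (cell_of a b c d j)) ->
    assocbit x y z = e -> odd (total n P) = e.
  by move=> /tE-> <-.
have le_m : (total n covered <= m)%N.
  by rewrite -card_cells -[X in (_ <= X)%N]card_ord max_card.
apply: leq_trans le_m; apply: (length_boundP ok).
- rewrite /weights_ok tA tB tC tD.
  by rewrite (w8 _ _ Va a2) (w8 _ _ Vb b2) (w8 _ _ Vc c2) (w8 _ _ Vd d2) !eqxx.
- rewrite tD card_gt0; apply: contraNneq d0 => d0.
  apply/eqP/rowP => j; rewrite mxE; apply/eqP.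
  by have := in_set0 j; rewrite -d0 inE => /negbFE.
- by split; [apply: i4 ab | apply: i4 ac | apply: i4 ad] => // j; rewrite !inE.
- by split; [apply: i4 bc | apply: i4 bd | apply: i4 cd] => // j; rewrite !inE.
by split; [apply: i2 abc | rewrite (i2 _ _ _ _ _ _ abd)
  | rewrite (i2 _ _ _ _ _ _ acd) | rewrite (i2 _ _ _ _ _ _ bcd)] => // j;
  rewrite !inE -andbA.
Qed.

(** * The sixteen codes *)

Section Generators.
Variable m : nat.
Implicit Types g h k : seq nat.

Lemma in_supp_vec_of g j : (j \in supp (vec_of m g)) = (j.+1 \in g).
Proof. by rewrite !inE mxE; case: (_ \in g). Qed.

Lemma card_ord_count (P : pred nat) (A : {set 'I_m}) :
  (forall j : 'I_m, (j \in A) = P j.+1) -> #|A| = count P (iota 1 m).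
Proof.
move=> AE; rewrite (iotaDl 1 0) count_map -sum1_count.
rewrite -[in RHS](subn0 m) -/(index_iota 0 m) big_mkord -sum1_card.
by apply: eq_bigl => j; rewrite AE.
Qed.

Definition meet2 g h := count [pred j | (j \in g) && (j \in h)] (iota 1 m).
Definition meet3 g h k :=
  count [pred j | [&& j \in g, j \in h & j \in k]] (iota 1 m).

Lemma card_supp2_vec_of g h :
  #|supp (vec_of m g) :&: supp (vec_of m h)| = meet2 g h.
Proof. by apply: card_ord_count => j; rewrite in_setI !in_supp_vec_of. Qed.

Lemma card_supp3_vec_of g h k :
  #|supp (vec_of m g) :&: supp (vec_of m h) :&: supp (vec_of m k)|
  = meet3 g h k.
Proof.
by apply: card_ord_count => j; rewrite !in_setI !in_supp_vec_of -andbA.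
Qed.

(** Sets of ordinals do not evaluate, so the hypotheses on a basis are tested by
    counting in lists of numbers; a vector is its own intersection with
    itself. *)
Definition gens_ok (lam : 10.-tuple 'F_2) (gs : seq (seq nat)) : bool :=
  let g1 := nth [::] gs 0 in let g2 := nth [::] gs 1 in
  let g3 := nth [::] gs 2 in let g4 := nth [::] gs 3 in
  let l := lambda_bit lam in
  let q g := odd (meet2 g g %/ 4) in
  let c g h := odd (meet2 g h %/ 2) in
  let t g h k := odd (meet3 g h k) in
  [&& [&& size gs == 4, all (fun g => 4 %| meet2 g g) gs,
          all (fun g => all (fun h => ~~ odd (meet2 g h)) gs) gs
        & 0 < meet2 g4 g4],
      [&& t g1 g2 g3, ~~ t g1 g2 g4, ~~ t g1 g3 g4 & ~~ t g2 g3 g4],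
      [&& q g1 == l 1, q g2 == l 2, q g3 == l 3 & q g4 == l 4],
      [&& c g1 g2 == l 5, c g1 g3 == l 6 & c g1 g4 == l 7]
    & [&& c g2 g3 == l 8, c g2 g4 == l 9 & c g3 g4 == l 10]]%N.

Lemma gens_okP lam gs : gens_ok lam gs ->
  exists a b c d : 'rV['F_2]_m,
    [/\ [seq vec_of m g | g <- gs] = [:: a; b; c; d],
        doubly_even <<[:: a; b; c; d]>>%VS, has_char lam a b c d & d != 0].
Proof.
have wtE g : wt (vec_of m g) = meet2 g g.
  by rewrite /wt -card_supp2_vec_of setIid.
have tE g h k :
    assocbit (vec_of m g) (vec_of m h) (vec_of m k) = odd (meet3 g h k).
  by rewrite /assocbit card_supp3_vec_of.
have qE g : sqbit (vec_of m g) = odd (meet2 g g %/ 4) by rewrite /sqbit wtE.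
have cE g h : commbit (vec_of m g) (vec_of m h) = odd (meet2 g h %/ 2).
  by rewrite /commbit card_supp2_vec_of.
rewrite /gens_ok => /and5P[/and4P[/eqP size_gs /allP gs4 /allP gs2]].
case: gs size_gs gs4 gs2 => [|g1 [|g2 [|g3 [|g4 [|//]]]]] // _ gs4 gs2 /=.
move=> g4_gt0.
move=> /and4P[t1 /negbTE t2 /negbTE t3 /negbTE t4].
move=> /and4P[/eqP q1 /eqP q2 /eqP q3 /eqP q4] /and3P[/eqP c1 /eqP c2 /eqP c3].
move=> /and3P[/eqP c4 /eqP c5 /eqP c6].
exists (vec_of m g1), (vec_of m g2), (vec_of m g3), (vec_of m g4); split=> //.
- rewrite -[X in <<X>>%VS]/[seq vec_of m g | g <- [:: g1; g2; g3; g4]].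
  apply: doubly_even_span =>
    [_ /mapP[g Sg ->]|_ _ /mapP[g Sg ->] /mapP[h Sh ->]].
    by rewrite wtE gs4.
  by rewrite card_supp2_vec_of; apply: (allP (gs2 g Sg)).
- by split; split; rewrite ?(tE, qE, cE).
- by apply: contraTneq g4_gt0 => g40; rewrite -wtE g40 /wt supp0 cards0.
Qed.

End Generators.

(** Big operators do not evaluate; folds do. *)
Lemma degree4E i : degree4 i = foldr maxn 0 [seq foldr maxn 0 g | g <- gens4 i].
Proof.
rewrite /degree4 !foldrE big_map; apply: eq_bigr => g _.
by rewrite foldrE.
Qed.

Lemma gens4_ok i : gens_ok (degree4 i) (lambda4 i) (gens4 i).
Proof.
rewrite degree4E.
by case: i; do 16?[case=> [?|]; first by vm_compute]; case.
Qed.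

Lemma degree4_bound i : length_bound (lambda_bit (lambda4 i)) (degree4 i).
Proof.
rewrite degree4E.
by case: i; do 16?[case=> [?|]; first by vm_compute]; case.
Qed.

Lemma rank4_basis n (W : {vspace 'rV['F_2]_n}) (C : code_loop W) lam :
  rank4_code_loop_with C lam ->
  exists a b c d : C,
    [/\ W = <<[:: vec a; vec b; vec c; vec d]>>%VS,
        free [:: vec a; vec b; vec c; vec d]
      & has_char lam (vec a) (vec b) (vec c) (vec d)].
Proof.
case=> dimW _ [a [b [c [d /is_char_vectorP[WE abcdP]]]]].
by exists a, b, c, d; split=> //; rewrite /free -WE dimW.
Qed.

Theorem theorem4 (i : 'I_16) :
  (exists (n : nat) (W : {vspace 'rV['F_2]_n}) (C : code_loop W),
     rank4_code_loop_with C (lambda4 i)) /\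
  (forall (n : nat) (W : {vspace 'rV['F_2]_n}) (C : code_loop W),
     rank4_code_loop_with C (lambda4 i) -> minimal_representation C (V4 i)).
Proof.
have [a [b [c [d [VE deV abcdP d0]]]]] := gens_okP (gens4_ok i).
rewrite /V4 VE; set V := <<_>>%VS in deV *.
have [Va Vb Vc Vd] : [/\ a \in V, b \in V, c \in V & d \in V].
  by split; apply: memv_span; rewrite !inE eqxx ?orbT.
have fV := has_char_free deV Va Vb Vc abcdP d0.
split.
  have [C] := code_loop_exists deV; exists (degree4 i), V, C.
  have Lvec v : v \in V -> exists x : C, vec x = v.
    by move=> Vv; exists (false, vsproj V v); rewrite /vec vsprojK.
  have [[x xa] [y yb] [z zc] [t td]] :=
    And4 (Lvec a Va) (Lvec b Vb) (Lvec c Vc) (Lvec d Vd).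
  have xyztP : is_char_vector (lambda4 i) x y z t.
    by apply/is_char_vectorP; rewrite xa yb zc td.
  split; first exact/eqP.
    apply: (@assocbit_nonassociative _ _ C x y z).
    by rewrite xa yb zc; case: abcdP => -[].
  by exists x, y, z, t.
move=> n W C /rank4_basis[x [y [z [t [WE fW xyztP]]]]].
have deW := cl_doubly_even C.
split.
  pose X := [:: vec x; vec y; vec z; vec t].
  apply: (same_invariants_representation (X := X) C WE) => //.
  - by move=> j lt_j; rewrite (has_char_sqbit xyztP) ?(has_char_sqbit abcdP).
  - move=> j k lt_j lt_k.
    rewrite (has_char_commbit deW _ _ _ _ xyztP) ?vecV //.
    by rewrite (has_char_commbit deV _ _ _ _ abcdP).
  - move=> j k l lt_j lt_k lt_l.
    rewrite (has_char_assocbit deW _ _ _ _ xyztP) ?vecV //.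
    by rewrite (has_char_assocbit deV _ _ _ _ abcdP).
move=> m' V' [L' [f f_bij]].
have f_inj := bij_inj f_bij; have [[abc _ _ _] _ _ _] := xyztP.
apply: (has_char_length (lam := lambda4 i) (cl_doubly_even L') (vecV (f x))
  (vecV (f y)) (vecV (f z)) (vecV (f t))); last exact: degree4_bound.
  rewrite /has_char !(iso_assocbit f_inj abc) !(iso_commbit f_inj abc).
  by rewrite !(iso_sqbit f_inj abc).
apply/eqP => /(iso_vec_eq0 f_inj abc) t0.
by move: fW; rewrite t0 !free_cons span_nil memv0 eqxx !andbF.
Qed.
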